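(* Let $a,b\in\mathbb N$ and let $B(F_2)$ be the stationary generalized Bratteli diagram with $A_2=A_2(a,b)=F_2^T$ the $\mathbb Z\times\mathbb Z$ matrix with entries $(A_2)_{i,i-1}=a$, $(A_2)_{i,i+1}=b$ for all $i\in\mathbb Z$ and all other entries zero. (1) If $a\ne b$, then there exist at least two tail-invariant infinite $\sigma$-finite measures $\mu$ and $\widetilde\mu$ on the path space $X_B$: the measure $\mu$ is determined by $\lambda=a+b$ and $\xi=(\dots,1,1,1,\dots)^T$, i.e. $\mu([\overline e])=\xi_v/\lambda^n$ for every finite path $\overline e$ from $V_0$ to $v\in V_n$; and the measure $\widetilde\mu$ is determined in the same way, $\widetilde\mu([\overline e])=\widetilde\xi_v/\widetilde\lambda^{\,n}$, by $\widetilde\lambda=2\sqrt{ab}$ and $\widetilde\xi=(\widetilde\xi_n)_{n\in\mathbb Z}^T$ with $\widetilde\xi_n=\left(\frac ab\right)^{n/2}$. (2) If $a=b$, then $\mu=\widetilde\mu$. The matrix $A_2(a,b)$ is null recurrent for any $a,b\in\mathbb N$.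
   Context: $\mathbb N=\{1,2,\dots\}$. The stationary generalized Bratteli diagram $B(F)$, $F=(f_{v,w})_{v,w\in\mathbb Z}$, has vertex levels $V_n=\mathbb Z$, $n\ge0$, and for every $n\ge0$ exactly $f_{v,w}$ edges from $w\in V_n$ to $v\in V_{n+1}$; $s,r$ denote source and range. The path space $X_B$ is the set of infinite paths $x=(x_i)_{i\ge0}$, where $x_i$ is an edge from $V_i$ to $V_{i+1}$ and $r(x_i)=s(x_{i+1})$, with the topology generated by the cylinder sets $[\overline e]=\{x: x_0=e_0,\dots,x_{n-1}=e_{n-1}\}$. A positive Borel measure $\mu$ on $X_B$ is tail-invariant if $\mu([\overline e])=\mu([\overline e'])$ for finite paths $\overline e,\overline e'$ from $V_0$ with $r(\overline e)=r(\overline e')$. For an irreducible non-negative infinite matrix $A$ (with $A^n=(a^{(n)}_{ij})$), the Perron eigenvalue is $\lambda_A=\limsup_n (a_{ii}^{(n)})^{1/n}$ (this definition covers periodic matrices; $A_2$ has period 2). $A$ is recurrent if $\sum_{n\ge0}a^{(n)}_{ii}\lambda_A^{-n}=\infty$. Put $l_{w,v}(1)=a_{w,v}$, $l_{w,v}(n+1)=\sum_{i\ne w}l_{w,i}(n)a_{i,v}$; a recurrent $A$ is null recurrent if $\sum_{n\ge1}n\,l_{w,w}(n)\lambda_A^{-n}=\infty$. *)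

(* Defs.v *)
From HB Require Import structures.
From mathcomp Require Import all_boot all_order all_algebra.
From mathcomp Require Import all_classical all_reals all_analysis.

Set Implicit Arguments.
Unset Strict Implicit.
Unset Printing Implicit Defensive.

Import Order.TTheory GRing.Theory Num.Theory.

Local Open Scope classical_set_scope.
Local Open Scope ring_scope.

(* [incidence B v w] is the number f_{v,w} of edges from w : V_n to
   v : V_(n+1).  Every vertex is required to emit an edge, so that the path
   space is inhabited: measurable types are pointed. *)
Record stationary_diagram := StationaryDiagram {
  incidence : int -> int -> nat;
  incidence_out : forall w, exists v, (0 < incidence v w)%N }.

Section Paths.
Variable B : stationary_diagram.

(* The edges between two consecutive levels, tagged by (source, range).  The
   diagram is stationary, so the level is left implicit: it is the position of
   the edge in a path. *)
Definition edge := {p : int * int & 'I_(incidence B p.2 p.1)}.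
Definition edge_source (e : edge) : int := (tag e).1.
Definition edge_range (e : edge) : int := (tag e).2.

Record infinite_path := InfinitePath {
  path_edge :> nat -> edge;
  path_edgeP : forall i, edge_range (path_edge i) = edge_source (path_edge i.+1) }.

Fixpoint edges_from (v : int) (s : seq edge) : bool :=
  if s is e :: s' then (edge_source e == v) && edges_from (edge_range e) s'
  else true.

(* A finite path starting in V_0; it ends in V_n, n being its number of edges.
   The path without edges at a vertex of V_0 is included. *)
Record finite_path := FinitePath {
  fpath_source : int;
  fpath_edges : seq edge;
  fpath_edgesP : edges_from fpath_source fpath_edges }.

Definition fpath_length (e : finite_path) : nat := size (fpath_edges e).
Definition fpath_range (e : finite_path) : int :=
  last (fpath_source e) (map edge_range (fpath_edges e)).

(* The first equation follows from the second one unless e has no edges. *)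
Definition cylinder (e : finite_path) : set infinite_path :=
  [set x | edge_source (x 0%N) = fpath_source e
         /\ mkseq x (fpath_length e) = fpath_edges e].

Lemma infinite_path_ex : exists x : nat -> edge,
  forall i, edge_range (x i) = edge_source (x i.+1).
Proof.
have out (w : int) : {e : edge | edge_source e = w}.
  apply: cid; have [v fvw] := incidence_out B w.
  by exists (existT _ (w, v) (Ordinal fvw)).
pose next (e : edge) := sval (out (edge_range e)).
exists (fun n => iter n next (sval (out 0))) => i.
exact: esym (svalP (out _)).
Qed.

HB.instance Definition _ := gen_eqMixin infinite_path.
HB.instance Definition _ := gen_choiceMixin infinite_path.
HB.instance Definition _ := isPointed.Build infinite_path
  (InfinitePath (svalP (cid infinite_path_ex))).
HB.instance Definition _ :=
  isSubBaseTopological.Build infinite_path (range cylinder) id.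

End Paths.

Notation borel_path_space B := (g_sigma_algebraType (@open (infinite_path B))).

Section Measures.
Variables (R : realType) (B : stationary_diagram).
Implicit Types mu nu : {measure set (borel_path_space B) -> \bar R}.

Definition tail_invariant mu := forall e e' : finite_path B,
  fpath_length e = fpath_length e' -> fpath_range e = fpath_range e' ->
  mu (cylinder e) = mu (cylinder e').

Definition infinite_measure mu := mu setT = +oo%E.

(* Measures are functions on all sets, whose values are meaningful on
   measurable sets only. *)
Definition same_measure mu nu := forall S : set (borel_path_space B),
  measurable S -> mu S = nu S.

Definition cylinder_formula mu (lam : R) (xi : int -> R) :=
  forall e : finite_path B,
    mu (cylinder e) = (xi (fpath_range e) / lam ^+ fpath_length e)%:E.

Definition determined_by mu (lam : R) (xi : int -> R) :=
  cylinder_formula mu lam xi /\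
  forall nu, cylinder_formula nu lam xi -> same_measure nu mu.

End Measures.

Section InfiniteMatrices.
Variable R : realType.
Implicit Types A : int -> int -> R.
Local Open Scope ereal_scope.

Fixpoint mat_pow A (n : nat) (i j : int) : \bar R :=
  if n is m.+1 then \esum_(k in [set: int]) (mat_pow A m i k * (A k j)%:E)
  else ((i == j)%:R)%:E.

Definition irreducible A :=
  forall i j, exists2 n, (0 < n)%N & 0 < mat_pow A n i j.

Definition perron_eigenvalue A (lam : R) := forall i,
  limn_esup (fun n => poweR (mat_pow A n i i) (n%:R^-1)%R) = lam%:E.

Definition recurrent A := exists2 lam : R, perron_eigenvalue A lam &
  forall i, \sum_(0 <= n <oo) (mat_pow A n i i * ((lam ^- n)%R)%:E) = +oo.

(* l_{w,v}(n); the value at n = 0 is not used. *)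
Fixpoint first_return A (w : int) (n : nat) (v : int) : \bar R :=
  match n with
  | 0 => 0
  | 1 => (A w v)%:E
  | m.+1 => \esum_(i in [set i | i != w]) (first_return A w m i * (A i v)%:E)
  end.

Definition null_recurrent A := [/\ irreducible A, recurrent A &
  exists2 lam : R, perron_eigenvalue A lam &
    forall w, \sum_(1 <= n <oo)
      ((n%:R)%:E * first_return A w n w * ((lam ^- n)%R)%:E) = +oo].

End InfiniteMatrices.

Definition A2 (a b : nat) (i j : int) : nat :=
  if j == i - 1 then a else if j == i + 1 then b else 0%N.

Definition F2 (a b : nat) (v w : int) : nat := A2 a b w v.

Lemma F2_out (a b : nat) (w : int) : (0 < a)%N ->
  exists v, (0 < F2 a b v w)%N.
Proof. by move=> a0; exists (w - 1); rewrite /F2 /A2 eqxx. Qed.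

Definition diagram_F2 (a b : nat) (a0 : (0 < a)%N) : stationary_diagram :=
  StationaryDiagram (fun w => F2_out b w a0).

(* Main.v *)
Require Import Defs.
From mathcomp Require Import finmap.
From mathcomp Require Import all_boot all_order all_algebra.
From mathcomp Require Import all_classical all_reals all_analysis.
From mathcomp Require Import zify ring lra.

Set Implicit Arguments.
Unset Strict Implicit.
Unset Printing Implicit Defensive.

Import Order.TTheory GRing.Theory Num.Theory.
Local Open Scope classical_set_scope.
Local Open Scope ring_scope.

(**
Measures.  Let B be any stationary diagram and let xi >= 0 satisfy
sum_v f_(v,w) xi_v = lam xi_w with lam > 0.  The cylinder values
xi_v / lam^n come from Lebesgue measure by a coding similar to the expansion
of a real number in base lam.  A real u in [0, xi_w) is turned into a path
starting at w: multiply u by lam; the interval [0, lam xi_w) is tiled by one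
interval of length xi_(range e) for each edge e out of w ([edge_tiling] with
[edge_esum]; this is the eigenvector equation); follow the edge whose tile
contains lam u and continue from its range with the position of lam u in that
tile.  The reals whose path starts with a given finite path from w to v of
length n then form an interval of length xi_v / lam^n
([itinerary_cylinder]).  Pushing forward the Lebesgue measure of [0, xi_w) and
summing over w gives the measure ([path_measure]).  It is the only one with
these values because cylinders are a countable pi-system generating the Borel
sets ([borel_cylinders], [cylinder_formula_unique]).  So everything about mu
and its companion reduces to the vectors: the constant vector and (a/b)^(n/2)
are eigenvectors ([eigenvector_measure], [geometric_eigenvector]); each has
infinitely many entries that are at least 1, whence infinite total mass; they
differ at the vertex 1 if and only if a <> b.

Null recurrence.  Put s = sqrt (a b) and t = sqrt (b / a).  Since t a = s and
s t = b, the matrix A_2 is s D^-1 S D, where D = diag (t^n) and S is the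
adjacency matrix of the line Z.  Hence the entries of A_2^n are numbers of
simple walks times s^n t^(j-i) ([mat_pow_A2]), and the same holds for
first-return sums, whose walk counts are given by the reflection principle
([first_return_A2_off]).  Every claim becomes one on central binomial
coefficients: with 4^m <= (m+1) C(2m,m) ([central_binomial_ge]) and
C(2m,m) <= 4^m the Perron eigenvalue is 2 s ([limn_esup_root]); the return
series dominates sum_m C(2m,m) / 4^m, and so does the series of the expected
return time, because the number of first returns at time 2m+2 is
2 C(2m,m) / (m+1).  Both diverge by comparison with the harmonic series.
*)

(** * Simple walks on the integers *)

(** The (0, d) entry of S^n: the number of n-step walks from 0 to d with steps
+1 and -1. *)
Fixpoint walks (n : nat) (d : int) : nat :=
  if n is m.+1 then (walks m (d - 1) + walks m (d + 1))%N else (d == 0).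

Lemma walksS n d : walks n.+1 d = (walks n (d - 1) + walks n (d + 1))%N.
Proof. by []. Qed.

Lemma walksN n d : walks n (- d) = walks n d.
Proof.
elim: n d => [|n IH] d /=; first by rewrite oppr_eq0.
rewrite addnC -[LHS](congr2 addn (IH _) (IH _)).
by congr addn; congr walks; lia.
Qed.

Lemma walks_le n d : (walks n d <= 2 ^ n)%N.
Proof.
elim: n d => [|n IH] d /=; first by case: eqP.
by rewrite expnS mul2n -addnn leq_add.
Qed.

Lemma walks_far n (d : int) : (n < `|d|)%N -> walks n d = 0%N.
Proof.
elim: n d => [|n IH] d /= nd; first by apply/eqP; rewrite eqb0; lia.
by rewrite !IH //; lia.
Qed.

(** A walk with m steps up and n - m steps down ends at 2m - n. *)
Lemma walks_binomial n m : walks n (m%:Z *+ 2 - n%:Z) = 'C(n, m).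
Proof.
elim: n m => [|n IH] [|m] //=.
- rewrite walks_far; last by lia.
  by rewrite add0n bin0 -(bin0 n) -IH; congr walks; lia.
rewrite binS addnC -!IH; congr addn; congr walks; lia.
Qed.

Lemma walks_central m : walks m.*2 0 = 'C(m.*2, m).
Proof. by rewrite -walks_binomial; congr walks; lia. Qed.

Lemma central_binomialS m :
  ('C(m.+1.*2, m.+1) * m.+1 = 'C(m.*2, m) * m.*2.+1.*2)%N.
Proof.
have E1 : (m.*2.+2 * 'C(m.*2.+1, m) = m.+1 * 'C(m.*2.+2, m.+1))%N.
  exact: mul_bin_diag.
have E2 : (m.*2.+1 * 'C(m.*2, m) = (m.*2.+1 - m) * 'C(m.*2.+1, m))%N.
  exact: mul_bin_down.
rewrite doubleS mulnC -E1.
have -> : (m.*2.+2 = 2 * (m.*2.+1 - m))%N by lia.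
by rewrite -mulnA -E2; lia.
Qed.

(** A weak form of the asymptotics C(2m,m) ~ 4^m / sqrt (pi m), which suffices
because the harmonic series already diverges. *)
Lemma central_binomial_ge m : (4 ^ m <= m.+1 * 'C(m.*2, m))%N.
Proof.
elim: m => [|m IH] //.
rewrite -(leq_pmul2r (ltn0Sn m)) -mulnA central_binomialS expnS.
have : (4 * 4 ^ m * m.+1 <= 4 * (m.+1 * 'C(m.*2, m)) * m.+1)%N.
  by rewrite leq_mul2r leq_mul2l IH.
move/leq_trans; apply.
nia.
Qed.

(** * Sums and series *)

Lemma esum_two_points (R : realType) (x y : int) (g : int -> \bar R) :
  (forall k, 0 <= g k)%E -> x != y ->
  (forall k, k != x -> k != y -> g k = 0%E) ->
  (\esum_(k in [set: int]) g k = g x + g y)%E.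
Proof.
move=> g0 xy gz.
transitivity (\esum_(k in [set x; y]) g k)%E.
  rewrite [RHS]esum_mkcond; apply: eq_esum => k _; case: ifPn => //.
  rewrite notin_setE /= => /not_orP[/eqP kx /eqP ky]; exact: gz.
rewrite esum_fset; [|by []|by move=> i _; exact: g0].
rewrite fsbigU0 ?fsbig_set1 //=.
by move=> i [/= -> iy]; move: xy; rewrite iy eqxx.
Qed.

Lemma harmonic_series_pinfty (R : realType) :
  (\sum_(n <oo) (n.+1%:R^-1 : R)%:E = +oo)%E.
Proof.
apply/cvg_lim => //.
have /nondecreasing_dvgn_lt : nondecreasing_seq (series (@harmonic R)).
  by apply/nondecreasing_series => n _ _; exact: harmonic_ge0.
move=> /(_ (@dvg_harmonic R))/cvgeryP.
by apply: cvg_trans; apply: near_eq_cvg; near=> n; rewrite sumEFin.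
Unshelve. all: by end_near. Qed.

(** Walks return only at even times, so divergence has to be read off from one
residue class of indices. *)
Lemma even_harmonic_series_pinfty (R : realType) (f : nat -> \bar R) N k :
  (forall n, 0 <= f n)%E -> (N <= k)%N ->
  (forall m, (m.+1%:R^-1)%:E <= f (m.*2 + k)%N)%E ->
  (\sum_(N <= n <oo) f n = +oo)%E.
Proof.
move=> f0 Nk fge; apply/eqP; rewrite -leye_eq eseries_cond nneseries_esum //.
pose e m := (m.*2 + k)%N.
have e_inj : set_inj [set: nat] e by move=> x y _ _; rewrite /e; lia.
apply: (@le_trans _ _ (\esum_(n in e @` [set: nat]) f n)%E); last first.
  rewrite esum_mkcond [leRHS]esum_mkcond; apply: le_esum => n _.
  case: ifPn; last by case: ifP.
  rewrite inE /= => -[m _ <-]; rewrite mem_set //= /e.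
  exact: leq_trans (leq_addl _ _).
rewrite esum_image // -harmonic_series_pinfty nneseries_esumT //.
by apply: le_esum => m _; exact: fge.
Qed.

(** Squaring Bernoulli's inequality gives a quadratic lower bound, which beats
the linear k + 1. *)
Lemma bernoulli_sqr_ge (R : realType) (h : R) k : 0 < h -> h ^- 2 <= k%:R ->
  k.+1%:R <= (1 + h) ^+ k.*2.
Proof.
move=> h0 hk.
have bern : 1 + k%:R * h <= (1 + h) ^+ k.
  elim: (k) => [|n IH]; first by rewrite mul0r addr0 expr0.
  rewrite exprS -natr1; apply: (@le_trans _ _ ((1 + h) * (1 + n%:R * h))).
    have : 0 <= n%:R * h ^+ 2 :> R by rewrite mulr_ge0 // sqr_ge0.
    by nra.
  by rewrite ler_pM2l // addr_gt0.
have hk2 : 1 <= k%:R * h ^+ 2 by rewrite -ler_pdivrMr ?exprn_gt0 // mul1r.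
rewrite -muln2 exprM.
have k0 : 0 <= k%:R * h by rewrite mulr_ge0 // ltW.
apply: (@le_trans _ _ ((1 + k%:R * h) ^+ 2)); last first.
  by rewrite ler_sqr ?nnegrE ?exprn_ge0 ?addr_ge0 // ltW.
rewrite -natr1.
have kn : 0 <= k%:R :> R by [].
nra.
Qed.

(** A polynomial loss in k disappears after taking the root of order 2k; the
odd terms are left free to vanish, as they do for a matrix of period 2. *)
Lemma limn_esup_root (R : realType) (u : nat -> R) (l : R) :
  0 < l -> (forall n, 0 <= u n <= l ^+ n) ->
  (forall k, l ^+ k.*2 <= k.+1%:R * u k.*2) ->
  limn_esup (fun n => ((u n)%:E `^ n%:R^-1)%E) = l%:E.
Proof.
move=> l0 ul lu.
have rootX (c : R) n : (0 < n)%N -> 0 <= c -> (c ^+ n) `^ n%:R^-1 = c.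
  move=> n0 c0; rewrite -powR_mulrn // -powRrM divff ?powRr1 //.
  by rewrite pnatr_eq0 -lt0n.
apply/eqP; rewrite eq_le; apply/andP; split.
  apply: (@le_trans _ _
      (ereal_sup [set ((u n)%:E `^ n%:R^-1)%E | n in [set n | (0 < n)%N]])).
    apply: ereal_inf_lbound; exists [set n | (0 < n)%N] => //.
    by exists 1%N.
  apply: ge_ereal_sup => _ [n /= n0 <-]; rewrite lee_fin.
  have /andP[un0 unl] := ul n.
  rewrite -[leRHS](rootX _ n n0 (ltW l0)); apply: ge0_ler_powR => //.
  by rewrite nnegrE exprn_ge0 // ltW.
apply: le_ereal_inf_tmp => _ [V [N _ NV] <-].
apply/lee_addgt0Pr => e e0.
(* u_2k >= (l / (1 + h))^2k for large k, and l / (1 + h) >= l - h l = l - e. *)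
pose h := e / l; have h0 : 0 < h by rewrite divr_gt0.
have [k [Nk k0 hk]] :
    exists k : nat, [/\ (N <= k.*2)%N, (0 < k)%N & h ^- 2 <= k%:R].
  pose k := (maxn N.+1 (Num.bound (h ^- 2)))%N.
  exists k; split; [by rewrite /k; lia|by rewrite /k; lia|].
  apply: (@le_trans _ _ (Num.bound (h ^- 2))%:R); last first.
    by rewrite ler_nat leq_maxr.
  by apply: ltW; apply: archi_boundP; rewrite invr_ge0 exprn_ge0 // ltW.
apply: (@le_trans _ _ (((u k.*2)%:E `^ k.*2%:R^-1) + e%:E))%E; last first.
  by apply: leeD => //; apply: ereal_sup_ubound; exists k.*2 => //; exact: NV.
pose c := l / (1 + h).
have h1 : 0 < 1 + h by rewrite addr_gt0.
have c0 : 0 <= c by rewrite divr_ge0 // ltW.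
have cu : c ^+ k.*2 <= u k.*2.
  rewrite expr_div_n ler_pdivrMr ?exprn_gt0 //.
  apply: le_trans (lu k) _; rewrite mulrC ler_wpM2l //.
    by case/andP: (ul k.*2).
  exact: bernoulli_sqr_ge.
rewrite -EFinD lee_fin; apply: (@le_trans _ _ (c + e)).
  have eE : e = h * l by rewrite /h divfK // gt_eqF.
  rewrite eE -lerBlDr /c ler_pdivlMr //.
  have : 0 <= h ^+ 2 * l by rewrite mulr_ge0 ?sqr_ge0 // ltW.
  by nra.
rewrite lerD2r -[leLHS](@rootX _ k.*2) ?double_gt0 //.
apply: ge0_ler_powR => //; first by rewrite nnegrE exprn_ge0.
by rewrite nnegrE; case/andP: (ul k.*2).
Qed.

(** * The matrix of the drifted walk *)

Section WalkMatrix.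
Variables (R : realType) (a b : nat).
Hypotheses (a0 : (0 < a)%N) (b0 : (0 < b)%N).

Let A (i j : int) : R := (A2 a b i j)%:R.
Let s : R := Num.sqrt (a%:R * b%:R).
Let t : R := s / a%:R.

Let aR0 : a%:R != 0 :> R. Proof. by rewrite pnatr_eq0 -lt0n. Qed.

Let s_gt0 : 0 < s.
Proof. by rewrite sqrtr_gt0 mulr_gt0 ?ltr0n. Qed.

Let t_neq0 : t != 0.
Proof. by rewrite mulf_neq0 ?invr_eq0 // gt_eqF. Qed.

Let t_gt0 : 0 < t. Proof. by rewrite divr_gt0 ?ltr0n. Qed.

Let taE : t * a%:R = s. Proof. by rewrite divfK. Qed.

Let stE : s * t = b%:R.
Proof.
have s2 : s * s = a%:R * b%:R by rewrite -expr2 sqr_sqrtr // mulr_ge0.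
by rewrite /t mulrA s2 mulrAC divff // mul1r.
Qed.

(** Only the rows j + 1 and j - 1 of A meet column j; this turns the infinite
matrix products into two-term recurrences. *)
Lemma A2_esum (f : int -> \bar R) j : (forall k, 0 <= f k)%E ->
  (\esum_(k in [set: int]) (f k * (A k j)%:E) =
   f (j + 1)%R * a%:R%:E + f (j - 1)%R * b%:R%:E)%E.
Proof.
move=> f0; rewrite (@esum_two_points _ (j + 1) (j - 1)); last 3 first.
- by move=> k; rewrite mule_ge0 // lee_fin ler0n.
- by apply/eqP; lia.
- move=> k /eqP kj1 /eqP kj2; rewrite /A /A2.
  case: eqP => [?|_]; first by lia.
  by case: eqP => [?|_]; [lia|rewrite mule0].
rewrite /A /A2 addrK subrK eqxx; congr (_ + _ * _%:R%:E)%E.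
by case: eqP => // ?; lia.
Qed.

(** The weights s^n t^d absorb the drift: t a = s and b / t = s, so a step in
either direction multiplies them by s and shifts d. *)
Lemma drift_rescale (x y : R) n (d : int) :
  x * s ^+ n * t ^ (d + 1) * a%:R + y * s ^+ n * t ^ (d - 1) * b%:R =
  (x + y) * s ^+ n.+1 * t ^ d.
Proof.
rewrite exprzDr ?unitfE // expr1z exprzDr ?unitfE // exprN1 -stE exprSr.
transitivity (x * s ^+ n * t ^ d * (t * a%:R)
              + y * s ^+ n * t ^ d * s * (t^-1 * t)); first by ring.
by rewrite taE mulVf //; ring.
Qed.

Lemma mat_pow_A2 n i j :
  mat_pow A n i j = ((walks n (j - i))%:R * s ^+ n * t ^ (j - i))%:E.
Proof.
elim: n i j => [|n IH] i j /=.
  rewrite subr_eq0 eq_sym; case: eqP => [->|_]; last by rewrite !mul0r.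
  by rewrite subrr !mul1r.
rewrite A2_esum; last first.
  by move=> k; rewrite IH lee_fin !mulr_ge0 ?exprn_ge0 ?exprz_ge0 // ltW.
rewrite !IH -!EFinM -EFinD; congr EFin.
have -> : j + 1 - i = (j - i) + 1 by lia.
have -> : j - 1 - i = (j - i) - 1 by lia.
by rewrite drift_rescale natrD [X in X * _ * _]addrC.
Qed.

Let lam : R := 2 * s.

Let lam_gt0 : 0 < lam. Proof. by rewrite mulr_gt0. Qed.

(** On the diagonal the weights t cancel, and dividing by lam^n = 2^n s^n leaves
the return probability of the simple symmetric walk. *)
Lemma mat_pow_A2_normalized n i :
  (mat_pow A n i i * (lam ^- n)%:E = ((walks n 0)%:R / 2 ^+ n)%:E)%E.
Proof.
rewrite mat_pow_A2 subrr expr0z mulr1 -EFinM; congr EFin.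
by rewrite exprMn invfM mulrACA divff ?mulr1 // expf_neq0 // gt_eqF.
Qed.

Lemma irreducible_A2 : irreducible A.
Proof.
move=> i j; have [m [n [n0 mn ijE]]] :
    exists m n : nat, [/\ (0 < n)%N, (m <= n)%N & j - i = m%:Z *+ 2 - n%:Z].
  (* n = |j - i| + 2 and m = n - 1 or m = 1 keep n positive when i = j. *)
  case: (leP i j) => ij; last by exists 1%N, (`|j - i|.+2)%N; split; lia.
  by exists (`|j - i|.+1)%N, (`|j - i|.+2)%N; split; lia.
exists n => //; rewrite mat_pow_A2 lte_fin.
apply: mulr_gt0; last exact: exprz_gt0.
by apply: mulr_gt0; rewrite ?exprn_gt0 // ltr0n ijE walks_binomial bin_gt0.
Qed.

Lemma central_binomial_ratio_ge m :
  m.+1%:R^-1 <= ('C(m.*2, m))%:R / 2 ^+ m.*2 :> R.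
Proof.
rewrite ler_pdivlMr ?exprn_gt0 // mulrC ler_pdivrMr ?ltr0n //.
rewrite -natrX -natrM ler_nat mulnC -[in leqLHS]mul2n expnM.
exact: central_binomial_ge.
Qed.

Lemma mat_pow_A2_series i :
  (\sum_(0 <= n <oo) (mat_pow A n i i * (lam ^- n)%:E) = +oo)%E.
Proof.
apply: (@even_harmonic_series_pinfty _ _ _ 0) => //.
  by move=> n; rewrite mat_pow_A2_normalized lee_fin divr_ge0 ?exprn_ge0.
move=> m; rewrite addn0 mat_pow_A2_normalized lee_fin walks_central.
exact: central_binomial_ratio_ge.
Qed.

(** Reflection principle: the walks of length n + 1 from 0 to d <> 0 that do not
come back to 0 are the walks of length n from 1 to |d|, minus those that hit 0,
which reflection puts in bijection with the walks from -1 to |d|. *)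
Let ballot n (d : int) : R :=
  (walks n (`|d| - 1))%:R - (walks n (`|d| + 1))%:R.

Let ballotS n (d : int) : d != 0 ->
  ballot n.+1 d = ballot n (d - 1) + ballot n (d + 1).
Proof.
wlog d_gt0 : d / 0 < d => [hw|_].
  move=> d0; have [d_lt0|d_ge0] := ltP d 0; last first.
    by apply: hw; rewrite // lt_def d0.
  have ballotN k c : ballot k (- c) = ballot k c by rewrite /ballot normrN.
  rewrite -(ballotN _ d) hw ?oppr_gt0 ?oppr_eq0 ?lt_eqF // addrC.
  rewrite -(ballotN n (d - 1)) -(ballotN n (d + 1)).
  by congr (ballot n _ + ballot n _); lia.
rewrite /ballot !walksS !natrD.
have -> : `|d - 1| = d - 1 by lia.
have -> : `|d + 1| = d + 1 by lia.
have -> : `|d| = d by lia.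
by rewrite !addrK; ring.
Qed.

Lemma first_return_ge0 w n v : (0 <= first_return A w n v)%E.
Proof.
elim: n v => [|[|n] IH] v //=; first by rewrite lee_fin ler0n.
by apply: esum_ge0 => i _; rewrite mule_ge0 // ?lee_fin ?ler0n //; exact: IH.
Qed.

(** Extending g by 0 at w makes the sum restricted to i <> w an unrestricted
one. *)
Lemma first_return_step w n v (g : int -> R) :
  (forall i, i != w -> first_return A w n.+1 i = (g i)%:E) -> g w = 0 ->
  first_return A w n.+2 v = (g (v + 1) * a%:R + g (v - 1) * b%:R)%:E.
Proof.
move=> gE gw; rewrite [LHS]/= esum_mkcond.
transitivity (\esum_(i in [set: int]) ((g i)%:E * (A i v)%:E))%E.
  apply: eq_esum => i _; case: ifPn => [|].
    by rewrite inE /= => /gE <-.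
  by rewrite notin_setE /= => /negP; rewrite negbK => /eqP ->; rewrite gw mul0e.
rewrite A2_esum ?EFinD ?EFinM // => i.
have [->|iw] := eqVneq i w; first by rewrite gw.
by rewrite -gE // first_return_ge0.
Qed.

Let taboo w n v : R := ballot n (v - w) * s ^+ n.+1 * t ^ (v - w).

(** The reflected count vanishes at d = 0, so it satisfies the recurrence of the
walks avoiding w next to w as well. *)
Let taboo_diag w n : taboo w n w = 0.
Proof.
by rewrite /taboo subrr /ballot normr0 sub0r add0r walksN subrr !mul0r.
Qed.

Lemma first_return_A2_off w n v : v != w ->
  first_return A w n.+1 v = (taboo w n v)%:E.
Proof.
elim: n v => [|n IH] v vw.
  rewrite /= /A /A2 /taboo /ballot /= expr1; congr EFin.
  case: eqP => [->|vw1].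
    rewrite (_ : w - 1 - w = -1); last by lia.
    by rewrite /= subr0 mul1r exprN1 -taE -mulrA mulrC divfK.
  case: eqP => [->|vw2].
    rewrite (_ : w + 1 - w = 1); last by lia.
    by rewrite /= subr0 mul1r expr1z stE.
  have -> : (`|v - w| - 1 == 0 :> int) = false by apply/eqP; lia.
  have -> : (`|v - w| + 1 == 0 :> int) = false by apply/eqP; lia.
  by rewrite subrr !mul0r.
rewrite (@first_return_step w n _ (taboo w n)) //; congr EFin.
rewrite /taboo ballotS ?subr_eq0 //.
have -> : v + 1 - w = (v - w) + 1 by lia.
have -> : v - 1 - w = (v - w) - 1 by lia.
by rewrite drift_rescale [X in X * _ * _]addrC.
Qed.

Lemma first_return_A2 w n : first_return A w n.+2 w =
  (2 * ((walks n 0)%:R - (walks n 2)%:R) * s ^+ n.+2)%:E.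
Proof.
rewrite (@first_return_step w n _ (taboo w n)) ?taboo_diag //; last first.
  by move=> i; exact: first_return_A2_off.
congr EFin; rewrite /taboo.
have -> : w + 1 - w = 0 + 1 by lia.
have -> : w - 1 - w = 0 - 1 by lia.
rewrite drift_rescale expr0z mulr1 /ballot; congr (_ * _).
by rewrite sub0r add0r normrN normr1 subrr; ring.
Qed.

(** The term of index n = 2m + 2 is exactly C(2m,m) / 4^m: the factor n cancels
the m + 1 in the Catalan number C(2m,m) / (m+1). *)
Lemma first_return_A2_series w :
  (\sum_(1 <= n <oo) (n%:R%:E * first_return A w n w * (lam ^- n)%:E)
   = +oo)%E.
Proof.
apply: (@even_harmonic_series_pinfty _ _ _ 2) => //.
  move=> n; rewrite !mule_ge0 ?first_return_ge0 ?lee_fin //.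
  by rewrite invr_ge0 exprn_ge0 // ltW.
move=> m; rewrite addn2 first_return_A2 -!EFinM lee_fin walks_central.
have -> : (2 : int) = m.+1%:Z *+ 2 - m.*2%:Z by lia.
rewrite walks_binomial.
apply: le_trans (central_binomial_ratio_ge m) _; rewrite le_eqVlt.
apply/orP; left; apply/eqP.
have ballot_central :
    'C(m.*2, m)%:R = m.+1%:R * ('C(m.*2, m)%:R - 'C(m.*2, m.+1)%:R) :> R.
  have E : (m.+1 * 'C(m.*2, m.+1) = m * 'C(m.*2, m))%N.
    by rewrite mul_bin_left -addnn addnK.
  by rewrite mulrBr -!natrM E mulSn natrD addrK.
rewrite [in LHS]ballot_central /lam exprMn invfM.
have -> : m.*2.+2%:R = 2 * m.+1%:R :> R by rewrite -natrM mul2n doubleS.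
have XSS (x : R) : x ^+ m.*2.+2 = x * x * x ^+ m.*2 by rewrite !exprS mulrA.
rewrite !XSS; have s0 := lt0r_neq0 s_gt0.
have sm0 := expf_neq0 m.*2 s0.
have p0 : (2 : R) ^+ m.*2 != 0 by rewrite expf_neq0.
by field; rewrite s0 sm0 p0.
Qed.

Lemma perron_eigenvalue_A2 : perron_eigenvalue A lam.
Proof.
move=> i; rewrite (_ : (fun n => _) =
    (fun n => (((walks n 0)%:R * s ^+ n)%:E `^ n%:R^-1)%E)); last first.
  by apply/funext => n; rewrite mat_pow_A2 subrr expr0z mulr1.
apply: limn_esup_root => // [n|k].
  apply/andP; split; first by rewrite mulr_ge0 ?exprn_ge0 // ltW.
  rewrite /lam exprMn ler_pM2r ?exprn_gt0 //.
  by rewrite -natrX ler_nat walks_le.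
rewrite /lam exprMn mulrA ler_pM2r ?exprn_gt0 // walks_central.
by rewrite -natrX -natrM ler_nat -[in leqLHS]mul2n expnM central_binomial_ge.
Qed.

Lemma null_recurrent_A2 : null_recurrent A.
Proof.
split; first exact: irreducible_A2.
  exists lam; first exact: perron_eigenvalue_A2.
  by move=> i; exact: mat_pow_A2_series.
exists lam; first exact: perron_eigenvalue_A2.
by move=> w; exact: first_return_A2_series.
Qed.

End WalkMatrix.

(** * Cylinders and the Borel sets of the path space *)

Section Cylinders.
Variable B : stationary_diagram.
Implicit Types (e : finite_path B) (x y : infinite_path B).

Lemma mkseqS_head T (f : nat -> T) n :
  mkseq f n.+1 = f 0%N :: mkseq (fun i => f i.+1) n.
Proof. by rewrite /mkseq /= -[1%N]addn0 iotaDl -map_comp. Qed.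

Lemma edges_from_mkseq (f : nat -> edge B) n :
  (forall i, edge_range (f i) = edge_source (f i.+1)) ->
  edges_from (edge_source (f 0%N)) (mkseq f n).
Proof.
elim: n f => [|n IH] f fE //.
by rewrite mkseqS_head /= eqxx /= fE; apply: IH => i; exact: fE.
Qed.

Definition prefix x n : finite_path B :=
  FinitePath (edges_from_mkseq n (@path_edgeP B x)).

Lemma finite_path_inj e e' :
  fpath_source e = fpath_source e' -> fpath_edges e = fpath_edges e' -> e = e'.
Proof.
case: e e' => w s es [w' s' es'] /= ww ss; subst w' s'.
by congr FinitePath; exact: bool_irrelevance.
Qed.

Lemma cylinder_prefix e x : cylinder e x -> e = prefix x (fpath_length e).
Proof. by case=> sx ex; apply: finite_path_inj. Qed.

Lemma prefix_cylinder x n : cylinder (prefix x n) x.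
Proof. by split => //=; rewrite /fpath_length /= size_mkseq. Qed.

Lemma subset_prefix x m n : (m <= n)%N ->
  cylinder (prefix x n) `<=` cylinder (prefix x m).
Proof.
move=> mn y [sy]; rewrite /fpath_length /= size_mkseq => yx.
split=> //=; rewrite /fpath_length /= size_mkseq.
have := congr1 (take m) yx; rewrite -!map_take !take_iota.
by have -> : minn m n = m by apply/minn_idPl.
Qed.

Lemma cylinderI e e' x : cylinder e x -> cylinder e' x ->
  cylinder e `&` cylinder e' =
  cylinder (prefix x (maxn (fpath_length e) (fpath_length e'))).
Proof.
move=> /cylinder_prefix ex /cylinder_prefix ex'.
rewrite {1}ex {1}ex'; have [mn|nm] := leqP (fpath_length e) (fpath_length e').
  by apply/seteqP; split=> [y []//|y ye]; split => //; exact: subset_prefix ye.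
apply/seteqP; split=> [y []//|y ye]; split => //.
by apply: subset_prefix ye; exact: ltnW.
Qed.

Lemma open_cylinder e : open (cylinder e).
Proof.
exists [set cylinder e]; last by rewrite bigcup_set1.
by move=> _ ->; apply: (finI_from1 id); exists e.
Qed.

(** Finite intersections of cylinders are handled pointwise: a long enough prefix
of x lies in all those that contain x. *)
Lemma prefix_bigcap (E : {fset set (infinite_path B)}) x :
  {subset E <= range (@cylinder B)} -> (forall C, C \in E -> C x) ->
  exists n, forall C, C \in E -> cylinder (prefix x n) `<=` C.
Proof.
move=> Ecyl Ex.
have /choice[N NE] : forall C, exists n,
    C \in E -> cylinder (prefix x n) `<=` C.
  move=> C; have [CE|] := boolP (C \in E); last by exists 0%N.
  have /set_mem[e _ eC] := Ecyl _ CE.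
  have := Ex _ CE; rewrite -eC => xe.
  by exists (fpath_length e) => _; rewrite -(cylinder_prefix xe) eC.
exists (\max_(C <- enum_fset E) N C)%N => C CE.
by apply: subset_trans (NE _ CE); apply: subset_prefix; exact: leq_bigmax_seq.
Qed.

(** Cylinders were only given as a subbase; they are in fact a base. *)
Lemma open_prefix (U : set (infinite_path B)) x : open U -> U x ->
  exists n, cylinder (prefix x n) `<=` U.
Proof.
move=> [D DI <-] [V /[dup] DV /DI [E Ecyl VE] Vx].
have [C CE|n nE] := @prefix_bigcap E x Ecyl.
  by move: Vx; rewrite -VE; exact.
exists n => y yn; exists V => //; change (V y).
by rewrite -VE => C CE; exact: nE yn.
Qed.

Lemma countable_finite_path : countable [set: finite_path B].
Proof.
apply/countable_injP.
exists (fun e => pickle (fpath_source e, fpath_edges e)) => e e' _ _.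
by move=> /(pcan_inj pickleK)[]; exact: finite_path_inj.
Qed.

(** The empty set is added because disjoint cylinders intersect in it. *)
Definition cylinder_pi_system : set (set (infinite_path B)) :=
  [set C | C = set0 \/ exists e, C = cylinder e].

Lemma cylinder_pi_systemI : setI_closed cylinder_pi_system.
Proof.
move=> C C' [->|[e ->]]; first by left; rewrite set0I.
move=> [->|[e' ->]]; first by left; rewrite setI0.
have [->|/set0P[x [xe xe']]] := eqVneq (cylinder e `&` cylinder e') set0.
  by left.
right; exists (prefix x (maxn (fpath_length e) (fpath_length e'))).
exact: cylinderI.
Qed.

(** An open set is the union of the cylinders that it contains, and there are
only countably many cylinders. *)
Lemma borel_cylinders :
  @measurable _ (borel_path_space B) = <<s cylinder_pi_system >>.
Proof.
apply/seteqP; split; apply: smallest_sub; first exact: smallest_sigma_algebra.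
- move=> U oU.
  pose F e := if `[< cylinder e `<=` U >] then cylinder e else set0.
  have -> : U = \bigcup_e F e.
    apply/seteqP; split => [x Ux|x [e _]]; last first.
      by rewrite /F; case: asboolP => [eU /eU|].
    have [n nU] := open_prefix oU Ux; exists (prefix x n) => //.
    by rewrite /F asboolT //; exact: prefix_cylinder.
  apply: (@countable_bigcupT_measurable _
    (g_sigma_algebraType cylinder_pi_system)); first exact: countable_finite_path.
  move=> e; rewrite /F; case: asboolP => _; last exact: measurable0.
  by apply: sub_sigma_algebra; right; exists e.
- exact: smallest_sigma_algebra.
- move=> _ [->|[e ->]]; first exact: (@measurable0 _ (borel_path_space B)).
  by apply: sub_sigma_algebra; exact: open_cylinder.
Qed.

Lemma measurable_cylinder e : measurable (cylinder e : set (borel_path_space B)).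
Proof. by apply: sub_sigma_algebra; exact: open_cylinder. Qed.

Definition vertex_path (w : int) : finite_path B :=
  @FinitePath B w [::] isT.

(** The partition of the path space by the initial vertex, numbered by a coding
of Z: it witnesses sigma-finiteness and lets uniqueness of measures apply. *)
Definition vertex_cylinders (n : nat) : set (infinite_path B) :=
  if @pickle_inv int n is Some w then cylinder (vertex_path w) else set0.

Lemma bigcup_vertex_cylinders : \bigcup_n vertex_cylinders n = setT.
Proof.
apply/seteqP; split=> // x _; exists (pickle (edge_source (x 0%N))) => //.
by rewrite /vertex_cylinders pickleK_inv; split.
Qed.

Lemma measurable_vertex_cylinders n :
  measurable (vertex_cylinders n : set (borel_path_space B)).
Proof.
rewrite /vertex_cylinders; case: pickle_inv => [w|]; first exact: measurable_cylinder.
exact: (@measurable0 _ (borel_path_space B)).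
Qed.

End Cylinders.

(** * Measures with prescribed cylinder values *)

Section CylinderFormula.
Variables (R : realType) (B : stationary_diagram).
Variables (lam : R) (xi : int -> R).
Implicit Types mu nu : {measure set (borel_path_space B) -> \bar R}.

Lemma cylinder_formula_tail_invariant mu :
  cylinder_formula mu lam xi -> tail_invariant mu.
Proof. by move=> muE e e' ll rr; rewrite !muE ll rr. Qed.

Lemma vertex_cylinders_finite mu n : cylinder_formula mu lam xi ->
  (mu (@vertex_cylinders B n) < +oo)%E.
Proof.
move=> muE; rewrite /vertex_cylinders; case: pickle_inv => [w|].
  by rewrite muE ltry.
by rewrite measure0.
Qed.

Lemma cylinder_formula_sigma_finite mu :
  cylinder_formula mu lam xi -> sigma_finite setT mu.
Proof.
move=> muE; exists (@vertex_cylinders B); first by rewrite bigcup_vertex_cylinders.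
move=> n; split; first exact: measurable_vertex_cylinders.
exact: vertex_cylinders_finite.
Qed.

Lemma cylinder_formula_unique mu nu :
  cylinder_formula mu lam xi -> cylinder_formula nu lam xi ->
  same_measure nu mu.
Proof.
move=> muE nuE S mS.
apply: (@measure_unique _ R (borel_path_space B) (@cylinder_pi_system B)
  (@vertex_cylinders B) _ _ _ _ nu mu) => //.
- exact: borel_cylinders.
- exact: cylinder_pi_systemI.
- move=> n; rewrite /vertex_cylinders; case: pickle_inv => [w|]; last by left.
  by right; exists (vertex_path B w).
- exact: bigcup_vertex_cylinders.
- by move=> _ [->|[e ->]]; rewrite ?measure0 // muE nuE.
- by move=> n; exact: vertex_cylinders_finite.
Qed.

(** The cylinders of paths starting at the vertices v n are disjoint, each of
mass at least 1. *)
Lemma cylinder_formula_infinite mu (v : nat -> int) :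
  injective v -> (forall n, 1 <= xi (v n)) ->
  cylinder_formula mu lam xi -> infinite_measure mu.
Proof.
move=> v_inj xi1 muE; apply/eqP; rewrite -leye_eq.
have mF n : measurable (cylinder (vertex_path B (v n)) : set (borel_path_space B)).
  exact: measurable_cylinder.
apply: (@le_trans _ _ (mu (\bigcup_n cylinder (vertex_path B (v n))))); last first.
  by apply: le_measure; rewrite ?inE //; exact: bigcup_measurable.
rewrite measure_bigcup //; last first.
  apply/trivIsetP => m n _ _ /eqP mn; rewrite -subset0 => x [[s1 _] [s2 _]].
  by apply: mn; apply: v_inj; exact: etrans (esym s1) s2.
rewrite (eq_eseriesl (Q := xpredT)); last by move=> n; rewrite mem_setT.
rewrite (@even_harmonic_series_pinfty _ _ 0 0) // => m.
rewrite addn0 muE /= expr0 divr1 lee_fin; apply: le_trans (xi1 _).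
by rewrite invf_le1 ?ltr0n // ler1n.
Qed.

End CylinderFormula.

(** * Coding paths by real numbers *)

(** The tiles are placed one after the other: the tile of e starts at the sum of
the lengths of the edges with the same source that precede e in a fixed
numbering.  They exhaust [0, xi w) because the lengths sum to xi w. *)
Lemma edge_tiling (R : realType) (B : stationary_diagram)
    (len : edge B -> R) (xi : int -> R) :
  (forall e, 0 <= len e) ->
  (forall w, (\esum_(e in [set e : edge B | edge_source e = w]) (len e)%:E
              = (xi w)%:E)%E) ->
  exists start : edge B -> R,
  [/\ forall e, 0 <= start e,
      forall e, start e + len e <= xi (edge_source e),
      forall w u, 0 <= u < xi w ->
        exists e, edge_source e = w /\ start e <= u < start e + len e
    & forall e e' u, edge_source e = edge_source e' ->
        start e <= u < start e + len e -> start e' <= u < start e' + len e' ->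
        e = e'].
Proof.
move=> len_ge0 len_sum.
(* Edges with another source get length 0, hence an empty tile. *)
pose om w n := if @pickle_inv (edge B) n is Some e
  then if edge_source e == w then len e else 0 else 0.
have om_ge0 w n : 0 <= om w n.
  by rewrite /om; case: pickle_inv => // e; case: ifP.
have omE e : om (edge_source e) (pickle e) = len e.
  by rewrite /om pickleK_inv eqxx.
have om_sum w : (\sum_(n <oo) (om w n)%:E = (xi w)%:E)%E.
  rewrite nneseries_esumT; last by move=> n; rewrite lee_fin.
  rewrite -len_sum; transitivity
      (\esum_(n in pickle @` [set e : edge B | edge_source e = w]) (om w n)%:E)%E.
    rewrite [RHS]esum_mkcond; apply: eq_esum => n _; case: ifPn => //.
    move=> /negP nP; congr EFin; rewrite /om.
    case en : pickle_inv => [e|//]; case: eqP => // ew.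
    exfalso; apply: nP; rewrite inE; exists e => //.
    by have := @pickle_invK (edge B) n; rewrite en.
  rewrite esum_image; last by move=> e e' _ _ /(pcan_inj pickleK).
  by apply: eq_esum => e /= <-; rewrite omE.
pose S w n := \sum_(i < n) om w i.
have SS w n : S w n.+1 = S w n + om w n by rewrite /S big_ord_recr.
have S_homo w m n : (m <= n)%N -> S w m <= S w n.
  elim: n => [|n IH]; first by rewrite leqn0 => /eqP ->.
  rewrite leq_eqVlt => /orP[/eqP -> //|mn].
  by apply: le_trans (IH mn) _; rewrite SS lerDl.
have S_le w n : S w n <= xi w.
  rewrite -lee_fin -om_sum /S -sumEFin -(big_mkord xpredT (fun i => (om w i)%:E)).
  by apply: nneseries_lim_ge => i _; rewrite lee_fin.
have S_cover w u : u < xi w -> exists n, u < S w n.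
  move=> uxi; apply/not_existsP => Su; move: uxi; apply/negP; rewrite -leNgt.
  rewrite -lee_fin -om_sum; apply: lime_le.
    by apply: is_cvg_nneseries => i _ _; rewrite lee_fin.
  apply: nearW => n; rewrite big_mkord sumEFin lee_fin leNgt; exact/negP/Su.
exists (fun e => S (edge_source e) (pickle e)); split.
- by move=> e; rewrite sumr_ge0.
- by move=> e; rewrite -omE -SS.
- move=> w u /andP[u0 /S_cover uS].
  have uS' : exists n, u < S w n by [].
  case: (ex_minnP uS') => -[|n] un nmin.
    by move: un; rewrite /S big_ord0 ltNge u0.
  have Su : S w n <= u by rewrite leNgt; apply/negP => /nmin; rewrite ltnn.
  have : 0 < om w n by have := le_lt_trans Su un; rewrite SS ltrDl.
  rewrite {1}/om; case en : pickle_inv => [e|]; last by rewrite ltxx.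
  have := @pickle_invK (edge B) n; rewrite en /= => pe.
  case: eqP => [ew _|_]; last by rewrite ltxx.
  by exists e; rewrite ew pe Su -omE ew pe -SS.
- move=> e e' u ee'; rewrite -!omE -!SS -ee' => /andP[l1 r1] /andP[l2 r2].
  apply: (pcan_inj pickleK); apply/eqP; rewrite eqn_leq.
  apply/andP; split; rewrite leqNgt; apply/negP => /(S_homo (edge_source e)) h.
    by have := lt_le_trans r2 (le_trans h l1); rewrite ltxx.
  by have := lt_le_trans r1 (le_trans h l2); rewrite ltxx.
Qed.

Section Itinerary.
Variables (R : realType) (B : stationary_diagram).
Variables (lam : R) (xi : int -> R).
Hypotheses (lam_gt0 : 0 < lam) (xi_ge0 : forall v, 0 <= xi v).

Variable start : edge B -> R.
Hypothesis start_ge0 : forall e, 0 <= start e.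
Hypothesis start_le : forall e,
  start e + xi (edge_range e) <= lam * xi (edge_source e).
Hypothesis start_cover : forall w u, 0 <= u < lam * xi w ->
  exists e, edge_source e = w /\ start e <= u < start e + xi (edge_range e).
Hypothesis start_uniq : forall e e' u, edge_source e = edge_source e' ->
  start e <= u < start e + xi (edge_range e) ->
  start e' <= u < start e' + xi (edge_range e') -> e = e'.

(** A default value that makes [step] total. *)
Definition out_edge (w : int) : edge B :=
  let: exist v fvw := cid (incidence_out B w) in existT _ (w, v) (Ordinal fvw).

(** The pair p is a vertex w with a real in [0, xi w). *)
Definition step (p : int * R) : edge B :=
  xget (out_edge p.1)
    [set e | edge_source e = p.1 /\
             start e <= lam * p.2 < start e + xi (edge_range e)].

Definition next (p : int * R) : int * R :=
  (edge_range (step p), lam * p.2 - start (step p)).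

Lemma step_source p : edge_source (step p) = p.1.
Proof.
rewrite /step; case: xgetP => [e _ [] //|_].
by rewrite /out_edge; case: cid.
Qed.

Lemma itinerary_subproof p i :
  edge_range (step (iter i next p)) = edge_source (step (iter i.+1 next p)).
Proof. by rewrite step_source. Qed.

Definition itinerary p : infinite_path B :=
  InfinitePath (path_edge := fun i => step (iter i next p)) (itinerary_subproof p).

Lemma step_eq e u :
  start e <= lam * u < start e + xi (edge_range e) ->
  step (edge_source e, u) = e.
Proof.
move=> eu; apply: xget_unique => [//|e' [ee' e'u]].
exact: start_uniq e'u eu.
Qed.

Lemma step_mem w u : 0 <= u < xi w ->
  start (step (w, u)) <= lam * u <
    start (step (w, u)) + xi (edge_range (step (w, u))).
Proof.
move=> /andP[u0 uw].
have /start_cover/(xgetPex (out_edge w)) : 0 <= lam * u < lam * xi w.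
  by rewrite pmulr_rge0 // u0 ltr_pM2l.
by rewrite -/(step (w, u)) => -[].
Qed.

(** Left endpoint of the interval of reals coding the paths that start with s. *)
Fixpoint offset (s : seq (edge B)) : R :=
  if s is e :: s' then (start e + offset s') / lam else 0.

Let width w (s : seq (edge B)) :=
  xi (last w (map (@edge_range B) s)) / lam ^+ size s.

Lemma width_cons w e s : width w (e :: s) = width (edge_range e) s / lam.
Proof. by rewrite /width /= exprSr invfM mulrA. Qed.

Lemma offset_bounds w s : edges_from w s ->
  0 <= offset s /\ offset s + width w s <= xi w.
Proof.
elim: s w => [|e s IH] w /=; first by rewrite /width /= divr1 add0r.
move=> /andP[/eqP ew /IH[ off0 offw]]; split.
  by rewrite divr_ge0 ?addr_ge0 // ltW.
rewrite width_cons -mulrDl ler_pdivrMr // [leRHS]mulrC -ew.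
by apply: le_trans (start_le e); rewrite -addrA lerD2l.
Qed.

(** One step is the affine map u |-> lam u - start e on the part of [0, xi w)
coding the edge e, so intervals pull back to intervals with lengths divided by
lam. *)
Lemma itinerary_cylinder w s u : edges_from w s -> 0 <= u < xi w ->
  (mkseq (itinerary (w, u)) (size s) = s) <->
  (offset s <= u < offset s + width w s).
Proof.
elim: s w u => [|e s IH] w u; first by rewrite /width /= divr1 add0r.
move=> /= /andP[/eqP ew es] uw; rewrite [size _]/= mkseqS_head.
have tailE : (fun i => itinerary (w, u) i.+1) = itinerary (next (w, u)).
  by apply/funext => i /=; rewrite -iterS iterSr.
have {}tailE : mkseq (fun i => itinerary (w, u) i.+1) (size s)
             = mkseq (itinerary (next (w, u))) (size s) by rewrite tailE.
rewrite tailE -[X in X :: _]/(step (w, u)).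
have scale : (start e + offset s) / lam <= u <
      (start e + offset s) / lam + width w (e :: s)
    <-> offset s <= lam * u - start e < offset s + width (edge_range e) s.
  rewrite width_cons -mulrDl ler_pdivrMr // ltr_pdivlMr // mulrC.
  by rewrite lerBrDl ltrBlDl addrA.
have range_mem : start e <= lam * u < start e + xi (edge_range e) ->
    0 <= lam * u - start e < xi (edge_range e).
  by rewrite subr_ge0 ltrBlDl.
rewrite scale; split.
  case=> se; have := step_mem uw; rewrite se => /range_mem eu.
  by rewrite /next se /= => /IH; apply.
move=> su.
have eu : start e <= lam * u < start e + xi (edge_range e).
  have [off0 offw] := offset_bounds es.
  move: su => /andP[lo hi]; rewrite -subr_ge0 -ltrBlDl; apply/andP; split.
    exact: le_trans lo.
  exact: lt_le_trans hi _.
have se : step (w, u) = e by rewrite -ew step_eq.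
rewrite se /next se /=; congr cons.
by apply/IH => //; exact: range_mem.
Qed.

(** The reals outside [0, xi w) will carry no mass; sending them all to one path
keeps the coding measurable. *)
Let clip w (u : R) := if 0 <= u < xi w then u else 0.

Definition coded_path w (u : R) : borel_path_space B :=
  itinerary (w, clip w u).

(** This interval has length xi_v / lam^n, which is where the cylinder values come
from. *)
Lemma coded_path_cylinder w e :
  `[0, xi w[ `&` coded_path w @^-1` cylinder e =
  if fpath_source e == w then
    [set` `[offset (fpath_edges e), offset (fpath_edges e) +
            xi (fpath_range e) / lam ^+ fpath_length e[] else set0.
Proof.
case: ifPn => [/eqP ew|/eqP ew]; last first.
  rewrite -subset0 => u [_ [/=]]; rewrite step_source /= => we _; exact/ew.
have es : edges_from w (fpath_edges e) by rewrite -ew fpath_edgesP.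
have [ off0 offw] := offset_bounds es.
apply/seteqP; split=> u /=; rewrite !in_itv /=.
  move=> [uw [_ ue]]; move: ue; rewrite /fpath_length itinerary_cylinder //.
    by rewrite /clip uw /width -ew.
  by rewrite /clip uw.
rewrite /fpath_range ew -/(width _ _) => ue.
have uw : 0 <= u < xi w.
  case/andP: ue => lo hi; apply/andP; split; first exact: le_trans lo.
  exact: lt_le_trans hi _.
split=> //; rewrite /coded_path /clip uw; split.
  by rewrite /= step_source ew.
exact/itinerary_cylinder.
Qed.

Lemma measurable_coded_path w :
  measurable_fun setT (coded_path w : measurableTypeR R -> borel_path_space B).
Proof.
apply: (@measurability _ _ (measurableTypeR R) (borel_path_space B) _ _
  (@cylinder_pi_system B)); first exact: borel_cylinders.
move=> _ [_ [->|[e ->]] <-].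
  by rewrite preimage_set0 setI0; exact: measurable0.
rewrite setTI -[X in measurable X]setTI -(setUv `[0, xi w[) setIUl.
have mI (I : interval R) : measurable ([set` I] : set (measurableTypeR R)).
  exact: measurable_itv.
apply: measurableU.
  rewrite (coded_path_cylinder w e).
  by case: ifP => _; [exact: mI|exact: measurable0].
(* xi w is outside [0, xi w), so the coded path there is the constant one. *)
rewrite (_ : _ `&` _ = if `[< cylinder e (coded_path w (xi w)) >]
                       then ~` `[0, xi w[ else set0).
  by case: ifP => _; [apply: measurableC; exact: mI|exact: measurable0].
have clipE u : (~` `[0, xi w[) u -> coded_path w u = coded_path w (xi w).
  rewrite /= in_itv /= => /negP/negbTE uw.
  by rewrite /coded_path /clip uw ltxx andbF.
apply/seteqP; case: asboolP => ce; split=> u //=.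
- by case.
- by move=> uw; split=> //; rewrite clipE.
- by move=> [uw]; rewrite clipE.
Qed.

Let lebesgue_on w : {measure set (measurableTypeR R) -> \bar R} :=
  mrestr lebesgue_measure (measurable_itv `[0, xi w[).

Lemma vertex_measure w : {m : {measure set (borel_path_space B) -> \bar R} |
  forall e, m (cylinder e) = if fpath_source e == w
    then (xi (fpath_range e) / lam ^+ fpath_length e)%:E else 0%E}.
Proof.
have mpath := measurable_coded_path w.
unshelve refine (exist _ (pushforward (lebesgue_on w) (coded_path w)
  : {measure set (borel_path_space B) -> \bar R}) _); first exact: mpath.
move=> e; rewrite /= /pushforward /lebesgue_on /mrestr setIC coded_path_cylinder.
case: ifP => _; last by rewrite measure0.
rewrite lebesgue_measure_itv /= lte_fin ltrDl -EFinB addrAC subrr add0r.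
case: ltP => // w_le0; congr EFin; apply/eqP; rewrite eq_le w_le0 andbT.
by rewrite divr_ge0 // exprn_ge0 // ltW.
Qed.

Lemma path_measure : exists mu : {measure set (borel_path_space B) -> \bar R},
  cylinder_formula mu lam xi.
Proof.
pose m n : {measure set (borel_path_space B) -> \bar R} :=
  if @pickle_inv int n is Some w then sval (vertex_measure w) else mzero.
exists (mseries m 0) => e.
rewrite /= /mseries (@nneseriesD1 R _ (pickle (fpath_source e))) //.
rewrite eseries0 ?adde0; last first.
  move=> n _ /= ne; rewrite /m; case en : pickle_inv => [w|//].
  rewrite (svalP (vertex_measure w)); case: eqP => // ew.
  have := @pickle_invK int n; rewrite en /= -ew => ne'.
  by move: ne; rewrite -ne' eqxx.
by rewrite /m pickleK_inv (svalP (vertex_measure _)) eqxx.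
Qed.

End Itinerary.

(** Sums over single edges are grouped by range; this connects the tiling, which
needs individual edges, with the eigenvector equation, which knows only their
number. *)
Lemma edge_esum (R : realType) (B : stationary_diagram) (xi : int -> R) w :
  (forall v, 0 <= xi v) ->
  (\esum_(e in [set e : edge B | edge_source e = w]) (xi (edge_range e))%:E =
   \esum_(v in [set: int]) ((incidence B v w)%:R * xi v)%:E)%E.
Proof.
move=> xi0.
transitivity (\esum_(p in [set: int] `*`` (fun v => `I_(incidence B v w)))
    (xi p.1)%:E)%E.
  rewrite (reindex_esum [set e : edge B | edge_source e = w] _
    (fun e => (edge_range e, \val (tagged e)))) //; split.
  - by case=> [[w' v] k] /= <-; split=> //=; exact: ltn_ord.
  - case=> [[w1 v1] k1] [[w2 v2] k2]; rewrite !inE => w1E w2E [v12 k12].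
    change (w1 = w) in w1E; change (w2 = w) in w2E; change (v1 = v2) in v12.
    by subst w1 w2 v2; congr existT; exact: val_inj.
  - move=> [v k] [_ /= kv]; exists (existT _ (w, v) (Ordinal kv)) => //.
rewrite -(esum_esum (a := fun v _ => (xi v)%:E)); last first.
  by move=> *; rewrite lee_fin.
apply: eq_esum => v _; rewrite esum_fset //; last by move=> *; rewrite lee_fin.
rewrite -fsbig_ord sumEFin sumr_const card_ord; congr EFin.
by rewrite mulr_natl.
Qed.

(** The tiling is applied to [0, lam xi_w), whose length is the sum of
xi_(range e) over the edges e out of w. *)
Theorem eigenvector_measure (R : realType) (B : stationary_diagram)
    (lam : R) (xi : int -> R) :
  0 < lam -> (forall v, 0 <= xi v) ->
  (forall w, \esum_(v in [set: int]) ((incidence B v w)%:R * xi v)%:E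
             = (lam * xi w)%:E)%E ->
  exists mu : {measure set (borel_path_space B) -> \bar R},
    determined_by mu lam xi.
Proof.
move=> lam0 xi0 eigen.
have [|w|start [start0 startle startc startu]] :=
  @edge_tiling R B (fun e => xi (edge_range e)) (fun w => lam * xi w).
- by [].
- by rewrite edge_esum.
have [mu muE] := path_measure lam0 xi0 start0 startle startc startu.
by exists mu; split => // nu; exact: cylinder_formula_unique.
Qed.

(** * The two eigenvectors *)

Lemma A2_eigenvector (R : realType) (a b : nat) (xi : int -> R) (w : int) :
  (forall v, 0 <= xi v) ->
  (\esum_(v in [set: int]) ((A2 a b w v)%:R * xi v)%:E
   = (a%:R * xi (w - 1) + b%:R * xi (w + 1))%:E)%E.
Proof.
move=> xi0; rewrite (@esum_two_points _ (w - 1) (w + 1)); first last.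
- move=> k /negPf k1 /negPf k2.
  by rewrite /A2 k1 k2 mul0r.
- by apply/eqP; lia.
- by move=> k; rewrite lee_fin mulr_ge0.
rewrite /A2 !eqxx EFinD; congr (_ + (_%:R * _)%:E)%E.
by case: eqP => // ?; lia.
Qed.

(** With q = sqrt (a / b) one has xi_(n+1) = q xi_n, while a / q and b q both equal
sqrt (a b). *)
Lemma geometric_eigenvector (R : realType) (a b : nat) (w : int) :
  (0 < a)%N -> (0 < b)%N ->
  let xi (n : int) : R := (a%:R / b%:R) `^ (n%:~R / 2) in
  a%:R * xi (w - 1) + b%:R * xi (w + 1) = 2 * Num.sqrt (a%:R * b%:R) * xi w.
Proof.
move=> a0 b0 xi; set r : R := a%:R / b%:R.
have aR : 0 < a%:R :> R by rewrite ltr0n.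
have bR : 0 < b%:R :> R by rewrite ltr0n.
have r0 : 0 < r by rewrite divr_gt0.
pose q := Num.sqrt r.
have q0 : 0 < q by rewrite sqrtr_gt0.
have bq : Num.sqrt (a%:R * b%:R) = b%:R * q.
  rewrite -[b%:R in RHS](ger0_norm (ltW bR)) -sqrtr_sqr -sqrtrM ?sqr_ge0 //.
  by congr Num.sqrt; rewrite /r; field; rewrite gt_eqF.
have aE : a%:R = b%:R * q * q.
  by rewrite -mulrA -expr2 sqr_sqrtr ?ltW // /r mulrCA divff ?mulr1 // gt_eqF.
have xiS n : xi (n + 1) = xi n * q.
  rewrite /xi -/r intrD mulrDl powRD; last by rewrite (gt_eqF r0) implybT.
  by rewrite mul1r powR12_sqrt // ltW.
rewrite -{2 3}[w](subrK 1) !xiS bq {1}aE; ring.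
Qed.

Theorem proposition7p10 (R : realType) (a b : nat)
    (a0 : (0 < a)%N) (b0 : (0 < b)%N) :
  (exists mu mut :
      {measure set (borel_path_space (diagram_F2 b a0)) -> \bar R},
    [/\ determined_by mu (a%:R + b%:R) (fun=> 1),
        determined_by mut (2 * Num.sqrt (a%:R * b%:R))
          (fun n : int => (a%:R / b%:R) `^ (n%:~R / 2)),
        a <> b ->
          [/\ tail_invariant mu /\ tail_invariant mut,
              infinite_measure mu /\ infinite_measure mut,
              sigma_finite setT mu /\ sigma_finite setT mut &
              ~ same_measure mu mut]
      & a = b -> same_measure mu mut])
  /\ null_recurrent (fun i j => (A2 a b i j)%:R : R).
Proof.
split; last exact: null_recurrent_A2.
have aR : 0 < a%:R :> R by rewrite ltr0n.
have bR : 0 < b%:R :> R by rewrite ltr0n.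
pose r : R := a%:R / b%:R.
have r0 : 0 < r by rewrite divr_gt0.
have [mu muP] :
    exists mu : {measure set (borel_path_space (diagram_F2 b a0)) -> \bar R},
    determined_by mu (a%:R + b%:R) (fun=> 1).
  apply: eigenvector_measure => // [|w]; first by rewrite addr_gt0.
  by rewrite mulrDl -(@A2_eigenvector R a b (fun=> 1) w).
have [mut mutP] :
    exists mut : {measure set (borel_path_space (diagram_F2 b a0)) -> \bar R},
    determined_by mut (2 * Num.sqrt (a%:R * b%:R))
      (fun n : int => r `^ (n%:~R / 2)).
  apply: eigenvector_measure => [||w].
  - by rewrite mulr_gt0 // sqrtr_gt0 mulr_gt0.
  - by move=> v; exact: powR_ge0.
  - rewrite -geometric_eigenvector //; apply: A2_eigenvector => v; exact: powR_ge0.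
have [[muE _] [mutE mut_uniq]] := (muP, mutP).
exists mu, mut; split=> // [ab|ab].
  split.
  - by split; apply: cylinder_formula_tail_invariant; [exact: muE|exact: mutE].
  - split; first by apply: (cylinder_formula_infinite (v := Posz)) muE => // m n [].
    (* (a / b)^(n/2) >= 1 for all n >= 0 or for all n <= 0. *)
    have [r1|r1] := leP 1 r.
      apply: (cylinder_formula_infinite (v := Posz)) mutE => [m n []//|n].
      by rewrite -[leLHS](powRr0 r) ler_powR // divr_ge0.
    apply: (cylinder_formula_infinite (v := fun n => - n%:Z)) mutE => [m n|n].
      by move=> /oppr_inj[].
    rewrite intrN mulNr powRN invr_ge1 ?unitfE ?gt_eqF ?powR_gt0 //.
    apply: (@le_trans _ _ (1 `^ (n%:~R / 2))); last by rewrite powR1.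
    by apply: ge0_ler_powR; rewrite ?nnegrE ?divr_ge0 ?ler0z //; exact: ltW.
  - by split; [exact: cylinder_formula_sigma_finite muE
              |exact: cylinder_formula_sigma_finite mutE].
  (* At the vertex 1 the values are 1 and sqrt (a / b). *)
  - move=> /(_ _ (measurable_cylinder (vertex_path _ 1))).
    rewrite muE mutE /= !expr0 !divr1 => -[] /esym.
    rewrite [fpath_range _]/= ?mulr1z mul1r powR12_sqrt ?ltW // => q1.
    apply: ab; apply/eqP; rewrite -(eqr_nat R) -[a%:R](divfK (lt0r_neq0 bR)).
    by rewrite -/r -(sqr_sqrtr (ltW r0)) q1 expr1n mul1r.
apply: mut_uniq; rewrite (_ : (fun n : int => _) = fun=> 1); last first.
  by apply/funext => n; rewrite /r -ab divff ?gt_eqF // powR1.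
rewrite (_ : 2 * _ = a%:R + b%:R) // -ab -expr2 sqrtr_sqr ger0_norm ?ltW //.
by rewrite mulr_natl mulr2n.
Qed.
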